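(* Let $\sigma\in\mathrm{Aut}_{\mathbb F}(A)$. For $i=1,\ldots,t$ let $\mathcal C_i\subseteq\mathbb F[z]^n$ be a minimal $\sigma$-cyclic convolutional code with support $\{l_i\}$ and complexity $\delta_i$, and assume $l_i\not\equiv_\sigma l_j$ for $i\ne j$. Then $\mathcal C:=\sum_{i=1}^t\mathcal C_i\subseteq\mathbb F[z]^n$ is a $\sigma$-cyclic convolutional code, too. Its rank is $\mathrm{rank}\,\mathcal C=\sum_{i=1}^t\mathrm{rank}\,\mathcal C_i=\sum_{i=1}^t\deg_x\pi_{l_i}$, and its complexity is $\delta_1+\cdots+\delta_t$. Furthermore, $\mathcal C=\bigoplus_{i=1}^t\mathcal C_i$, and the Forney indices of $\mathcal C$ are given by the union (counted with multiplicities) of the Forney indices of the codes $\mathcal C_1,\ldots,\mathcal C_t$.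
   Context: Convolutional codes. $\mathbb F$ is a finite field. Every submodule $\mathcal S\subseteq\mathbb F[z]^n$ is free; if it has rank $k$, then $\mathcal S=\mathrm{im}\,G:=\{uG\mid u\in\mathbb F[z]^k\}$ (row vectors) for some rank-$k$ matrix $G\in\mathbb F[z]^{k\times n}$ (a generator matrix). The complexity of $\mathcal S$ is the maximal degree of the $k$-minors of $G$ (independent of the choice of $G$). A convolutional code with parameters $(n,k,\delta)$ is a submodule $\mathrm{im}\,G\subseteq\mathbb F[z]^n$ of rank $k$ and complexity $\delta$ with $G$ right invertible over $\mathbb F[z]$; equivalently, a direct summand of $\mathbb F[z]^n$. The degree of a vector polynomial is the largest power of $z$ having a nonzero coefficient vector. A generator matrix is minimal if the sum of its row degrees equals $\delta$; its row degrees are then uniquely determined by the submodule up to order and are called the Forney indices. Cyclic structure. The length $n\ge 1$ and $|\mathbb F|$ are coprime. $A:=\mathbb F[x]/\langle x^n-1\rangle$ and $x^n-1=\pi_1\cdots\pi_r$ with monic irreducible pairwise different $\pi_i\in\mathbb F[x]$, ordered by nondecreasing degree. For $k=1,\ldots,r$, $\varepsilon^{(k)}\in A$ is the primitive idempotent with $\varepsilon^{(k)}\equiv\delta_{kj}\pmod{\pi_j}$ for all $j$. $\mathrm{Aut}_{\mathbb F}(A)$ is the group of $\mathbb F$-algebra automorphisms of $A$; each such $\sigma$ permutes the $\varepsilon^{(k)}$. Write $k\equiv_\sigma l$ if $\sigma^i(\varepsilon^{(k)})=\varepsilon^{(l)}$ for some integer $i\ge0$ (an equivalence relation on $\{1,\ldots,r\}$).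 Let $A[z;\sigma]$ be the skew-polynomial ring with elements $\sum_j z^ja_j$ ($a_j\in A$, coefficients on the right), usual addition, and multiplication determined by $az=z\sigma(a)$ for $a\in A$. For $g\in A[z;\sigma]$ let ${}^{\bullet}\langle g\rangle:=\{fg\mid f\in A[z;\sigma]\}$. Let $\mathfrak p:\mathbb F[z]^n\to A[z;\sigma]$ be the isomorphism of left $\mathbb F[z]$-modules $\sum_j z^jv_j\mapsto\sum_j z^j\mathfrak p(v_j)$, where $\mathfrak p(v_0,\ldots,v_{n-1})=\sum_i v_ix^i\bmod(x^n-1)$ on $\mathbb F^n$. A convolutional code $\mathcal C\subseteq\mathbb F[z]^n$ is $\sigma$-cyclic if $\mathfrak p(\mathcal C)$ is a left ideal of $A[z;\sigma]$. Components and reducedness. For $f\in A[z;\sigma]$ put $f^{(k)}:=\varepsilon^{(k)}f$ and $T_f:=\{k\mid f^{(k)}\ne0\}$ (support of $f$). $f$ is called a component if $f=f^{(k)}$ for some $k$. Monomials are the elements $z^\mu\varepsilon^{(k)}$, ordered by $z^\mu\varepsilon^{(k)}<z^\nu\varepsilon^{(l)}$ iff $\mu<\nu$, or $\mu=\nu$ and $k<l$. The terms of $f=\sum_\nu z^\nu f_\nu$ are the elements $z^\nu\varepsilon^{(l)}f_\nu$; for $f\neq 0$, $LM(f)$ is the largest monomial $z^\mu\varepsilon^{(k)}$ with $\varepsilon^{(k)}f_\mu\ne0$. $f$ is reduced if for all $k\ne l$ (with $f^{(l)}\neq0$) no nonzero term of $f^{(k)}$ is right divisible by $LM(f^{(l)})$,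 i.e. equals $h\cdot LM(f^{(l)})$ with $h\in A[z;\sigma]$. It is known that for every $\sigma$-cyclic code $\mathcal C$ there is a reduced $g$, unique up to left multiplication by units of $A$, with $\mathfrak p(\mathcal C)={}^{\bullet}\langle g\rangle$; it is called a generator polynomial of $\mathcal C$, and $T_g$ is called the support of $\mathcal C$. A nonzero $\sigma$-cyclic code is called minimal if its generator polynomial is a component. *)

(* Defs.v *)
From HB Require Import structures.
From mathcomp Require Import all_boot all_order all_algebra.
From mathcomp Require Import qpoly.
From mathcomp Require Import boolp classical_sets.

Set Implicit Arguments.
Unset Strict Implicit.
Unset Printing Implicit Defensive.

Import GRing.Theory.
Local Open Scope ring_scope.
Local Open Scope classical_set_scope.

(** [\sum_j z^j a_j], coefficients on the right, is stored as the [{poly A}]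
    with coefficients [a_j]; since [a z = z sigma(a)], one has
    [(z^i a)(z^j b) = z^(i+j) sigma^j(a) b]. *)

Definition skew_poly (A : nzRingType) (sigma : {rmorphism A -> A}) : Type :=
  {poly A}.

HB.instance Definition _ (A : nzRingType) (sigma : {rmorphism A -> A}) :=
  GRing.Zmodule.copy (skew_poly sigma) {poly A}.

Section SkewRing.
Variables (A : nzRingType) (sigma : {rmorphism A -> A}).
Implicit Types f g h : skew_poly sigma.

Definition skew_mul f g : skew_poly sigma :=
  \poly_(m < size f + size g)
     \sum_(j < m.+1) iter j sigma f`_(m - j) * g`_j.

Definition skew_one : skew_poly sigma := (1 : {poly A}).

Lemma iter_rmorph0 j : iter j sigma 0 = 0.
Proof. by elim: j => //= j ->; rewrite rmorph0. Qed.

Lemma iter_rmorph1 j : iter j sigma 1 = 1.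
Proof. by elim: j => //= j ->; rewrite rmorph1. Qed.

Lemma iter_rmorphD j : {morph iter j sigma : a b / a + b}.
Proof. by move=> a b; elim: j => //= j ->; rewrite rmorphD. Qed.

Lemma iter_rmorphM j : {morph iter j sigma : a b / a * b}.
Proof. by move=> a b; elim: j => //= j ->; rewrite rmorphM. Qed.

Lemma coef_skew_mul f g m :
  (skew_mul f g)`_m = \sum_(j < m.+1) iter j sigma f`_(m - j) * g`_j.
Proof.
rewrite coef_poly; case: ltnP => // le_m; rewrite big1 // => j _.
case: (ltnP j (size g)) => lt_jg; last by rewrite (nth_default _ lt_jg) mulr0.
rewrite [f`_(m - j)]nth_default ?iter_rmorph0 ?mul0r //.
by rewrite -(addnK j (size f)) leq_sub2r // (leq_trans _ le_m) // leq_add2l ltnW.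
Qed.

Lemma skew_mulA : associative skew_mul.
Proof.
move=> f g h; apply/polyP => m; rewrite !coef_skew_mul.
pose T (l j : nat) :=
  iter l sigma f`_(m - l) * (iter j sigma g`_(l - j) * h`_j).
transitivity (\sum_(l < m.+1) \sum_(j < m.+1 | (j <= l)%N) T l j).
  apply: eq_bigr => l _; rewrite coef_skew_mul big_distrr /=.
  by rewrite (big_ord_narrow_leq (ltn_ord l : (l <= m)%N)).
rewrite (exchange_big_dep predT) //=; apply: eq_bigr => j _.
have le_jm : (j <= m)%N := ltn_ord j.
rewrite coef_skew_mul (big_morph _ (iter_rmorphD j) (iter_rmorph0 j)).
rewrite big_distrl /=.
pose F l := if (j <= l)%N then T l j else 0.
transitivity (\sum_(l < m.+1) F l); first by rewrite big_mkcond.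
rewrite -(big_mkord xpredT F) (big_cat_nat _ (n := j)) //=; last exact: leqW.
rewrite big_nat_cond big1 ?add0r => [|l]; last first.
  by rewrite andbT /F => /= lt_lj; rewrite leqNgt lt_lj.
rewrite -{1}[val j]add0n big_addn subSn // big_mkord.
apply: eq_bigr => i _; rewrite /F leq_addl /T addnK iter_rmorphM mulrA.
by rewrite addnC iterD subnDA.
Qed.

Lemma skew_mul1f : left_id skew_one skew_mul.
Proof.
move=> f; apply/polyP => m; rewrite coef_skew_mul big_ord_recr /= subnn.
rewrite coef1 eqxx iter_rmorph1 mul1r big1 ?add0r // => j _.
by rewrite coef1 subn_eq0 leqNgt ltn_ord iter_rmorph0 mul0r.
Qed.

Lemma skew_mulf1 : right_id skew_one skew_mul.
Proof.
move=> f; apply/polyP => m; rewrite coef_skew_mul big_ord_recl /= subn0.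
rewrite coef1 eqxx mulr1 big1 ?addr0 // => j _.
by rewrite coef1 mulr0.
Qed.

Lemma skew_mulDl : left_distributive skew_mul +%R.
Proof.
move=> f g h; apply/polyP => m; rewrite coefD !coef_skew_mul -big_split /=.
by apply: eq_bigr => j _; rewrite coefD iter_rmorphD mulrDl.
Qed.

Lemma skew_mulDr : right_distributive skew_mul +%R.
Proof.
move=> f g h; apply/polyP => m; rewrite coefD !coef_skew_mul -big_split /=.
by apply: eq_bigr => j _; rewrite coefD mulrDr.
Qed.

Lemma skew_one_neq0 : skew_one != 0 :> skew_poly sigma.
Proof. exact: poly1_neq0. Qed.

End SkewRing.

HB.instance Definition _ (A : nzRingType) (sigma : {rmorphism A -> A}) :=
  GRing.Zmodule_isNzRing.Build (skew_poly sigma) (@skew_mulA A sigma)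
    (@skew_mul1f A sigma) (@skew_mulf1 A sigma) (@skew_mulDl A sigma)
    (@skew_mulDr A sigma) (@skew_one_neq0 A sigma).

Section SkewPolynomials.
Variables (A : nzRingType) (sigma : {rmorphism A -> A}).

Definition skewC (a : A) : skew_poly sigma := a%:P.
Definition skewX : skew_poly sigma := ('X : {poly A}).

(** [z^mu a] *)
Definition skew_term (mu : nat) (a : A) : skew_poly sigma := a *: 'X^mu.

Lemma skew_comm (a : A) : skewC a * skewX = skewX * skewC (sigma a).
Proof.
apply/polyP => m; rewrite !coef_skew_mul.
case: m => [|m].
  by rewrite !big_ord_recl !big_ord0 /= !coefX !mulr0 !mul0r.
rewrite big_ord_recl big_ord_recl /= coefX mulr0 add0r coefX mulr1.
rewrite subn1 /= coefC [in RHS]big_ord_recl /= coefX coefC /=.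
rewrite big1 ?addr0 => [|j _]; last by rewrite coefX mulr0.
rewrite big1 ?addr0 => [|j _]; last by rewrite coefC mulr0.
by case: m => [|m] /=; rewrite ?rmorph0 ?mul1r ?mul0r.
Qed.

Lemma skew_termE mu a : skew_term mu a = skewX ^+ mu * skewC a.
Proof.
have mulC (f : skew_poly sigma) i : (f * skewC a)`_i = f`_i * a.
  rewrite coef_skew_mul big_ord_recl /= subn0 coefC eqxx big1 ?addr0 // => j _.
  by rewrite coefC mulr0.
have expX : skewX ^+ mu = ('X^mu : {poly A}).
  elim: mu => [|mu IH] //; apply/polyP => i.
  rewrite exprSr IH coef_skew_mul coefXn; case: i => [|i].
    by rewrite big_ord_recl big_ord0 coefX mulr0 addr0.
  rewrite big_ord_recl big_ord_recl /= coefX mulr0 add0r coefX mulr1.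
  rewrite big1 ?addr0 => [|j _]; last by rewrite coefX mulr0.
  by rewrite subn1 coefXn eqSS /=; case: eqP; rewrite ?rmorph1 ?rmorph0.
apply/polyP => i; rewrite mulC expX coefZ coefXn.
by case: eqP; rewrite ?mulr0 ?mulr1 ?mul0r ?mul1r.
Qed.

Definition left_ideal (R : nzRingType) (I : set R) : Prop :=
  I 0 /\ forall a u v : R, I u -> I v -> I (a * u + v).

Definition principal_left_ideal (R : nzRingType) (g : R) : set R :=
  [set f * g | f in [set: R]].

Definition right_divides (R : nzRingType) (d f : R) : Prop :=
  exists h : R, f = h * d.

Variables (r : nat) (eps : 'I_r -> A).
Implicit Types (f g : skew_poly sigma) (k l m : 'I_r).

Definition component k f : skew_poly sigma := skewC (eps k) * f.

Definition skew_support f : {set 'I_r} := [set k | component k f != 0]%SET.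

Definition is_component f : Prop := exists k, f = component k f.

Definition monomial_lt (mu : nat) k (nu : nat) l : bool :=
  (mu < nu)%N || (mu == nu) && (k < l)%N.

(** [LM(f) = z^mu eps_m]; no such [(mu, m)] exists when [f = 0] *)
Definition is_lead_monomial f (mu : nat) m : Prop :=
  eps m * f`_mu != 0 /\
  forall nu l, eps l * f`_nu != 0 -> ~~ monomial_lt mu m nu l.

Definition reduced f : Prop :=
  forall k l mu m, k != l -> is_lead_monomial (component l f) mu m ->
  forall nu j, skew_term nu (eps j * (component k f)`_nu) != 0 ->
  ~ right_divides (skew_term mu (eps m))
                  (skew_term nu (eps j * (component k f)`_nu)).

Definition idem_equiv k l : Prop := exists i : nat, iter i sigma (eps k) = eps l.

End SkewPolynomials.

Section Codes.
Variables (F : fieldType) (n : nat).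
Implicit Types S : set 'rV[{poly F}]_n.

Definition im_mx k (G : 'M[{poly F}]_(k, n)) : set 'rV[{poly F}]_n :=
  [set u *m G | u in [set: 'rV[{poly F}]_k]].

Definition generator_matrix k (G : 'M[{poly F}]_(k, n)) S : Prop :=
  \rank (map_mx (@tofrac {poly F}) G) = k /\ S = im_mx G.

(** If [G] has rank [k], this does not depend on the choice of [G] but only on
    [im_mx G], whose complexity it is. *)
Definition max_minor_degree k (G : 'M[{poly F}]_(k, n)) : nat :=
  \max_(c : {ffun 'I_k -> 'I_n} |
          [forall i : 'I_k, forall j : 'I_k, (i < j)%N ==> (c i < c j)%N])
     (size (\det (colsub c G))).-1.

Definition conv_code S (k delta : nat) : Prop :=
  exists G : 'M[{poly F}]_(k, n),
    [/\ generator_matrix G S,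
        exists H : 'M[{poly F}]_(n, k), G *m H = 1%:M
      & max_minor_degree G = delta].

Definition row_degree k (G : 'M[{poly F}]_(k, n)) (i : 'I_k) : nat :=
  \max_(j < n) (size (G i j)).-1.

Definition minimal_generator k (G : 'M[{poly F}]_(k, n)) S : Prop :=
  generator_matrix G S /\ (\sum_(i < k) row_degree G i)%N = max_minor_degree G.

Definition Forney_indices S (s : seq nat) : Prop :=
  exists (k : nat) (G : 'M[{poly F}]_(k, n)),
    minimal_generator G S /\ perm_eq s [seq row_degree G i | i <- enum 'I_k].

Definition sum_modules t (C : 'I_t -> set 'rV[{poly F}]_n) :
    set 'rV[{poly F}]_n :=
  [set v | exists2 c : 'I_t -> 'rV[{poly F}]_n,
             forall i, C i (c i) & v = \sum_(i < t) c i].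

Definition direct_sum_of S t (C : 'I_t -> set 'rV[{poly F}]_n) : Prop :=
  S = sum_modules C /\
  forall c : 'I_t -> 'rV[{poly F}]_n,
    (forall i, C i (c i)) -> \sum_(i < t) c i = 0 -> forall i, c i = 0.

End Codes.

(** [F[x]/(x^n - 1)]; [{poly %/ h}] is the intended quotient only if [h] is
    monic and nonconstant, i.e., here, only for [n > 0]. *)
Notation cyclic_alg F n := {poly %/ ('X^n - 1 : {poly F})}.

Section Cyclic.
Variables (F : finFieldType) (n : nat).

Definition is_factorization r (pi : 'I_r -> {poly F}) : Prop :=
  [/\ 'X^n - 1 = \prod_(i < r) pi i,
      forall i, pi i \is monic /\ irreducible_poly (pi i),
      injective pi
    & forall i j : 'I_r, (i <= j)%N -> (size (pi i) <= size (pi j))%N].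

(** By the Chinese remainder theorem the congruences determine [eps]. *)
Definition is_primitive_idempotents r (pi : 'I_r -> {poly F})
    (eps : 'I_r -> cyclic_alg F n) : Prop :=
  forall k j : 'I_r, pi j %| (eps k : {poly F}) - (k == j)%:R.

Variable sigma : {lrmorphism cyclic_alg F n -> cyclic_alg F n}.

Definition poly_of_row (v : 'rV[F]_n) : cyclic_alg F n :=
  in_qpoly ('X^n - 1) (rVpoly v).

(** [\sum_j z^j v_j |-> \sum_j z^j p(v_j)] *)
Definition poly_of_vec (v : 'rV[{poly F}]_n) : skew_poly sigma :=
  \poly_(j < \max_(i < n) size (v ord0 i))
     poly_of_row (\row_(i < n) (v ord0 i)`_j).

Definition sigma_cyclic (C : set 'rV[{poly F}]_n) : Prop :=
  (exists k delta, conv_code C k delta) /\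
  left_ideal [set poly_of_vec v | v in C].

Variables (r : nat) (eps : 'I_r -> cyclic_alg F n).

Definition generator_polynomial (g : skew_poly sigma)
    (C : set 'rV[{poly F}]_n) : Prop :=
  reduced eps g /\ [set poly_of_vec v | v in C] = principal_left_ideal g.

(** The next two notions do not depend on [g], which is unique up to left
    multiplication by units of the cyclic algebra. *)
Definition has_support (C : set 'rV[{poly F}]_n) (T : {set 'I_r}) : Prop :=
  exists2 g, generator_polynomial g C & skew_support eps g = T.

Definition minimal_code (C : set 'rV[{poly F}]_n) : Prop :=
  [/\ sigma_cyclic C, C <> [set 0]
    & exists2 g, generator_polynomial g C & is_component eps g].

End Cyclic.

(* Main.v *)
From HB Require Import structures.
Require Import Defs.
From mathcomp Require Import all_boot all_order all_algebra perm.
From mathcomp Require Import qpoly.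
From mathcomp Require Import boolp classical_sets.

(** The reason is that inequivalent supports live in different blocks of the
    skew polynomial ring. Let [e_i] be the sum of the primitive idempotents
    [eps k] with [k] equivalent to [l i]. The generator [g] of [C i] satisfies
    [g = eps (l i) g], so its coefficient at [z^m] lies in
    [sigma^m (eps (l i)) A], and the coefficients of its left multiples are
    sums of elements of such ideals. As [e_i] fixes each of these ideals
    pointwise, multiplication by [e_i] fixes the coefficients of every element
    of [C i] ([fixed_by_class_idem]). Moreover [e_i e_j = 0] for
    [i != j] ([class_idem_orth]). Multiplication by [e_i] on [A] is [F]-linear,
    hence given by a constant matrix [E_i] in coordinates, and the codes become
    submodules with [v E_i = v] on [C i] and [E_i E_j = 0].

    For submodules separated by constant orthogonal matrices in this sense the
    claims on sums are linear algebra over [F[z]]. The sum is direct since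
    [E_i] extracts the component in [C i], and right inverses [H_i] of
    generator matrices assemble to a right inverse [(E_1 H_1 ... E_t H_t)] of
    the stacked matrix. The heart is the additivity of the complexity,
    [max_minor_degree_col_mx], from which the statement on Forney indices
    follows as well: stacking minimal generator matrices concatenates the row
    degrees, so the sum of the row degrees remains the complexity. Additivity
    rests on one device. If [B] is a square submatrix of [G] whose
    determinant has the maximal degree [D], then by Cramer's rule the entries
    of [adj(B) G] are minors of [G], so they have degree at most [D]; as
    [det(adj B) det B = (det B)^k], this bounds the degree of [det (G Q)] by [D]
    for every constant [Q]. Applied blockwise it bounds the minors of the
    stack by [D_1 + D_2]; and the constant matrix built from the two maximal
    choices of columns and from [E_1], [E_2] attains this bound.

    The rank of [C i] is found from right multiplication by [g], which is
    injective on [A[z;sigma] (eps l)] because leading coefficients multiply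
    inside the field [A (eps l)], of dimension [deg (pi l)] over [F]
    ([mulf_support1_inj]). So the products [x^a (eps l) g] with
    [a < deg (pi l)] are an [F[z]]-basis of the code. *)

Set Implicit Arguments.
Unset Strict Implicit.
Unset Printing Implicit Defensive.

Import GRing.Theory.
Local Open Scope ring_scope.

(** * Degrees of minors of polynomial matrices *)

Section MinorDegree.
Variables (F : fieldType).
Local Notation frac := (map_mx (@tofrac {poly F})).
Local Notation constmx := (map_mx (@polyC F)).

Lemma size_det_le k (M : 'M[{poly F}]_k) (d : 'I_k -> nat) :
  (forall i j, size (M i j) <= (d i).+1)%N ->
  (size (\det M) <= (\sum_(i < k) d i).+1)%N.
Proof.
move=> sM; apply: leq_trans (size_sum _ _ _) _; apply/bigmax_leqP => s _.
rewrite size_Msign.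
pose P (p : {poly F}) (e : nat) := (size p <= e.+1)%N.
apply: (big_ind2 P) => [||i _]; rewrite /P ?size_poly1 //.
move=> p d1 q d2 s1 s2; apply: leq_trans (size_polyMleq _ _) _.
by rewrite -subn1 leq_subLR add1n -addnS -addSn leq_add.
Qed.

(** The maximal minor degree only refers to increasing choices of columns;
    sorting extends the bound to arbitrary choices, at the price of a sign, and
    a repeated column gives determinant zero. *)
Lemma size_minor_le k n (G : 'M[{poly F}]_(k, n)) (f : 'I_k -> 'I_n) :
  (size (\det (colsub f G)) <= (max_minor_degree G).+1)%N.
Proof.
case: (boolP (injectiveb f)); last first.
  case/injectivePn=> i [j ne_ij eq_f].
  rewrite -det_tr (determinant_alternate ne_ij) ?size_poly0 // => a.
  by rewrite !mxE eq_f.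
move/injectiveP=> f_inj.
pose le_ord : rel 'I_n := fun x y => (x <= y)%N.
pose s := [tuple f i | i < k].
have /tuple_permP[p sortE] : perm_eq (sort le_ord s) s by rewrite perm_sort.
pose c : {ffun 'I_k -> 'I_n} := [ffun i => f (p i)].
have sorted_s : sorted le_ord (sort le_ord s).
  by apply: sort_sorted => x y; apply: leq_total.
have c_incr : [forall i : 'I_k, forall j : 'I_k, (i < j)%N ==> (c i < c j)%N].
  apply/'forall_forallP => i j; apply/implyP => lt_ij.
  have nthE (a : 'I_k) : nth (f i) (sort le_ord s) a = f (p a).
    by rewrite sortE -tnth_nth !tnth_mktuple.
  have sz : size (sort le_ord s) = k by rewrite size_sort size_tuple.
  rewrite ltn_neqAle !ffunE; apply/andP; split.
    rewrite (inj_eq val_inj) (inj_eq f_inj) (inj_eq perm_inj) neq_ltn.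
    by rewrite lt_ij.
  rewrite -!nthE.
  have le_trans : transitive le_ord by move=> x y z; apply: leq_trans.
  have le_refl : reflexive le_ord by move=> x; apply: leqnn.
  have mono := sorted_leq_nth le_trans le_refl (f i) sorted_s.
  by apply: (mono i j); rewrite ?inE ?sz ?ltn_ord // ltnW.
have -> : \det (colsub f G) = (-1) ^+ p * \det (colsub c G).
  have -> : colsub c G = col_perm p (colsub f G).
    by apply/matrixP => i j; rewrite !mxE ffunE.
  rewrite col_permE det_mulmx det_perm mulrCA -signr_addb odd_permV addbb.
  by rewrite mulr1.
rewrite size_Msign; apply: leq_trans (leqSpred _) _; rewrite ltnS.
exact: (@leq_bigmax_cond _ _
  (fun c : {ffun _} => (size (\det (colsub c G))).-1)).
Qed.

(** Some minor reaches the maximal degree, but it may be the zero polynomial when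
    this degree is zero, by the convention on its degree. In that case full rank
    provides a nonzero minor, and it is constant. *)
Lemma max_minor_attained k n (G : 'M[{poly F}]_(k, n)) :
  \rank (frac G) = k ->
  exists2 c : 'I_k -> 'I_n, \det (colsub c G) != 0
    & size (\det (colsub c G)) = (max_minor_degree G).+1.
Proof.
move=> rkG; have fullGT : row_full (frac G)^T.
  by rewrite /row_full mxrank_tr rkG.
pose f := fullrankfun fullGT.
have f_nz : \det (colsub f G) != 0.
  have := fullrowsub_unit fullGT; rewrite unitmxE unitfE.
  by rewrite -trmx_mxsub det_tr -map_mxsub det_map_mx tofrac_eq0.
have := size_minor_le G f; set D := max_minor_degree G.
have [D0 | D_gt0] := posnP D.
  rewrite D0 => sf; exists f => //.
  by apply/eqP; rewrite eqn_leq sf size_poly_gt0.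
move=> _; pose Inc := fun c : {ffun 'I_k -> 'I_n} =>
  [forall i : 'I_k, forall j : 'I_k, (i < j)%N ==> (c i < c j)%N].
have [|c _ Dc] := @eq_bigmax_cond _ Inc
    (fun c : {ffun _} => (size (\det (colsub c G))).-1).
  rewrite lt0n; apply/eqP => Inc0; move: D_gt0; rewrite /D /max_minor_degree.
  by rewrite big_pred0 // => c; apply: (card0_eq Inc0).
have sc : (size (\det (colsub c G))).-1 = D by rewrite -Dc.
have c_nz : \det (colsub c G) != 0.
  by apply: contraTneq D_gt0 => c0; rewrite -sc c0 size_poly0.
by exists c => //; rewrite -sc prednK // size_poly_gt0.
Qed.

(** Cramer's rule: the product with the adjugate replaces column [i] of the
    chosen square submatrix by column [j] of [G]. *)
Lemma adj_colsub_minor k n (G : 'M[{poly F}]_(k, n)) (c : 'I_k -> 'I_n) i j :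
  (\adj (colsub c G) *m G) i j =
  \det (colsub (fun a => if a == i then j else c a) G).
Proof.
rewrite (expand_det_col _ i) mxE; apply: eq_bigr => a _.
rewrite !mxE eqxx mulrC; congr (_ * _).
congr (_ * \det _); apply/matrixP => u v; rewrite !mxE.
by rewrite eq_sym (negPf (neq_lift _ _)).
Qed.

(** Comparing degrees in [det (A N) det B = det N (det A det B)]: the row degree
    bounds on [A N] add up to exactly the degree of [det A det B], which leaves
    [deg (det N) <= deg (det B)]. It is used with [A] the
    adjugate of [B], or with block diagonal matrices of this kind. *)
Lemma size_det_le_cofactor k (A B N : 'M[{poly F}]_k) (d : 'I_k -> nat) :
    size (\det A * \det B) = (\sum_(i < k) d i).+1 ->
    (forall i j, size ((A *m N) i j) <= (d i).+1)%N ->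
  (size (\det N) <= size (\det B))%N.
Proof.
move=> sAB sAN; have := size_det_le sAN; rewrite det_mulmx => sdet.
have [->|N_nz] := eqVneq (\det N) 0; first by rewrite size_poly0.
have: \det A * \det B != 0 by rewrite -size_poly_gt0 sAB.
rewrite mulf_eq0 => /norP[A_nz B_nz]; move: sdet; rewrite -sAB !size_mul //.
have: (0 < size (\det A))%N by rewrite size_poly_gt0.
by case: (size (\det A)) => // a _; rewrite !addSn /= leq_add2l.
Qed.

Lemma size_adj_colsub_mul k n m (G : 'M[{poly F}]_(k, n)) (Q : 'M[F]_(n, m))
    (c : 'I_k -> 'I_n) i j :
  (size ((\adj (colsub c G) *m G *m constmx Q) i j)
     <= (max_minor_degree G).+1)%N.
Proof.
rewrite mxE; apply: leq_trans (size_sum _ _ _) _; apply/bigmax_leqP => a _.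
rewrite [constmx Q a j]mxE mulrC mul_polyC.
by rewrite (leq_trans (size_scale_leq _ _)) // adj_colsub_minor size_minor_le.
Qed.

Lemma size_exp_det k (p : {poly F}) d :
  size p = d.+1 -> size (p ^+ k) = (\sum_(i < k) d).+1.
Proof.
move=> sp; have := size_exp p k; rewrite sp /= sum_nat_const card_ord mulnC.
move=> <-; rewrite prednK // size_poly_gt0 expf_neq0 //.
by rewrite -size_poly_gt0 sp.
Qed.

Lemma det_adjM k (B : 'M[{poly F}]_k) : \det (\adj B) * \det B = \det B ^+ k.
Proof. by rewrite -det_mulmx mul_adj_mx det_scalar. Qed.

(** The minors of [G] are the determinants of [G Q] for [Q] a column selection;
    allowing any constant [Q] does not raise the degree. *)
Lemma size_det_mul_const k n (G : 'M[{poly F}]_(k, n)) (Q : 'M[F]_(n, k)) :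
  \rank (frac G) = k ->
  (size (\det (G *m constmx Q)) <= (max_minor_degree G).+1)%N.
Proof.
move=> /max_minor_attained[c c_nz sc]; rewrite -sc.
apply: (@size_det_le_cofactor _ (\adj (colsub c G)) _ _
          (fun=> max_minor_degree G)).
  by rewrite det_adjM; apply: size_exp_det.
by move=> i j; rewrite mulmxA size_adj_colsub_mul.
Qed.

Lemma rank_col_mx_sep (K : fieldType) k1 k2 n (G1 : 'M[K]_(k1, n))
    (G2 : 'M[K]_(k2, n)) (E1 E2 : 'M[K]_n) :
    G1 *m E1 = G1 -> G2 *m E2 = G2 -> G1 *m E2 = 0 -> G2 *m E1 = 0 ->
    \rank G1 = k1 -> \rank G2 = k2 ->
  \rank (col_mx G1 G2) = (k1 + k2)%N.
Proof.
move=> G11 G22 G12 G21 /eqP/row_freeP[H1 GH1] /eqP/row_freeP[H2 GH2].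
apply/eqP/row_freeP; exists (row_mx (E1 *m H1) (E2 *m H2)).
rewrite mul_col_mx !mul_mx_row !mulmxA G11 G22 G12 G21 !mul0mx GH1 GH2.
by rewrite -[col_mx _ _]/(block_mx _ _ _ _) -scalar_mx_block.
Qed.

Section Separated.

Variables (n k1 k2 : nat) (E1 E2 : 'M[F]_n).
Variables (G1 : 'M[{poly F}]_(k1, n)) (G2 : 'M[{poly F}]_(k2, n)).
Hypotheses (G11 : G1 *m constmx E1 = G1) (G22 : G2 *m constmx E2 = G2).
Hypotheses (G12 : G1 *m constmx E2 = 0) (G21 : G2 *m constmx E1 = 0).
Hypotheses (rk1 : \rank (frac G1) = k1) (rk2 : \rank (frac G2) = k2).

Lemma rank_col_mx_separated : \rank (frac (col_mx G1 G2)) = (k1 + k2)%N.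
Proof.
rewrite map_col_mx.
apply: (@rank_col_mx_sep _ _ _ _ _ _ (frac (constmx E1)) (frac (constmx E2)));
  by rewrite // -map_mxM (G11, G22, G12, G21) // raddf0.
Qed.

Lemma max_minor_degree_col_mx :
  max_minor_degree (col_mx G1 G2)
    = (max_minor_degree G1 + max_minor_degree G2)%N.
Proof.
set G := col_mx G1 G2; set D1 := max_minor_degree G1.
set D2 := max_minor_degree G2.
have [c1 c1_nz sc1] := max_minor_attained rk1.
have [c2 c2_nz sc2] := max_minor_attained rk2.
set B1 := colsub c1 G1 in c1_nz sc1; set B2 := colsub c2 G2 in c2_nz sc2.
have [c c_nz sc] := max_minor_attained rank_col_mx_separated.
rewrite -/G in c c_nz sc.
have sB : size (\det B1 * \det B2) = (D1 + D2).+1.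
  by rewrite size_mul // sc1 sc2 addSn addnS.
apply/eqP; rewrite eqn_leq; apply/andP; split; rewrite -ltnS.
  rewrite -sc -sB -(det_ublock _ 0).
  (* Upper bound: multiply the stack by both adjugates, blockwise. *)
  pose d (i : 'I_(k1 + k2)) := if split i is inl _ then D1 else D2.
  pose A := block_mx (\adj B1) 0 0 (\adj B2).
  apply: (@size_det_le_cofactor _ A _ _ d).
    rewrite /A !det_ublock mulrACA !det_adjM.
    rewrite size_mul ?expf_neq0 // (size_exp_det _ sc1) (size_exp_det _ sc2).
    rewrite addSn addnS /=; congr (_.+1); rewrite big_split_ord /=.
    congr (_ + _)%N; apply: eq_bigr => i _; rewrite /d.
      by rewrite (unsplitK (inl i)).
    by rewrite (unsplitK (inr i)).
  have -> : colsub c G = G *m constmx (colsub c 1%:M).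
    by rewrite map_mxsub map_scalar_mx mulmx_colsub mulmx1.
  move=> i j; rewrite /A /G mulmxA mul_block_col !mul0mx addr0 add0r.
  rewrite mul_col_mx mxE /d.
  by case: (split i) => a; apply: size_adj_colsub_mul.
(* Lower bound: thanks to E1 and E2, the constant matrix Q cuts out both maximal
   minors at once, as the diagonal blocks of the product. *)
pose Q := row_mx (E1 *m colsub c1 1%:M) (E2 *m colsub c2 1%:M).
have GQ : G *m constmx Q = block_mx B1 0 0 B2.
  rewrite /G /Q map_row_mx !map_mxM mul_col_mx !mul_mx_row !mulmxA.
  rewrite G11 G22 G12 G21 !mul0mx !map_mxsub !map_scalar_mx.
  by rewrite !mulmx_colsub !mulmx1.
by rewrite -sB -(det_ublock _ 0) -GQ size_det_mul_const ?rank_col_mx_separated.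
Qed.

End Separated.
End MinorDegree.

(** * Sums of modules separated by constant matrices *)

Section SeparatedSums.
Variables (F : fieldType) (n : nat).
Local Notation constmx := (map_mx (@polyC F)).
Implicit Types (S : set 'rV[{poly F}]_n) (E : 'M[F]_n).

Definition fixed_by E S := forall v, S v -> v *m constmx E = v.

Definition sum2 S1 S2 : set 'rV[{poly F}]_n :=
  [set v | exists v1 v2, [/\ S1 v1, S2 v2 & v = v1 + v2]]%classic.

Lemma im_mx_row k (G : 'M[{poly F}]_(k, n)) i : im_mx G (row i G).
Proof. by exists (delta_mx 0 i) => //; rewrite -rowE. Qed.

Lemma fixed_by_mulmx E k (G : 'M[{poly F}]_(k, n)) :
  fixed_by E (im_mx G) -> G *m constmx E = G.
Proof.
move=> fixE; apply/row_matrixP => i.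
by rewrite row_mul fixE //; apply: im_mx_row.
Qed.

Lemma im_col_mx k1 k2 (G1 : 'M[{poly F}]_(k1, n)) (G2 : 'M[{poly F}]_(k2, n)) :
  im_mx (col_mx G1 G2) = sum2 (im_mx G1) (im_mx G2).
Proof.
apply/seteqP; split=> [_ [u _ <-]|_ [_ [_ [[u1 _ <-] [u2 _ <-] ->]]]] /=.
  rewrite -[u]hsubmxK mul_row_col.
  by exists (lsubmx u *m G1), (rsubmx u *m G2); split=> //;
    [exists (lsubmx u) | exists (rsubmx u)].
by exists (row_mx u1 u2) => //; rewrite mul_row_col.
Qed.

Lemma constmxM_eq0 E1 E2 k (G : 'M[{poly F}]_(k, n)) :
  G *m constmx E1 = G -> E1 *m E2 = 0 -> G *m constmx E2 = 0.
Proof. by move=> <- E12; rewrite -mulmxA -map_mxM E12 raddf0 mulmx0. Qed.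

Lemma im_mx0 (G : 'M[{poly F}]_(0, n)) : [set 0]%classic = im_mx G.
Proof.
apply/seteqP; split=> [_ ->|_ [u _ <-]] /=.
  by exists 0 => //; rewrite mul0mx.
by rewrite flatmx0 mulmx0.
Qed.

Lemma generator_matrix0 (G : 'M[{poly F}]_(0, n)) :
  generator_matrix G [set 0]%classic.
Proof. by split; [rewrite flatmx0 mxrank0 | exact: im_mx0]. Qed.

Lemma max_minor_degree0 (G : 'M[{poly F}]_(0, n)) : max_minor_degree G = 0%N.
Proof.
rewrite /max_minor_degree big1 // => c _.
by rewrite det_mx00 size_poly1.
Qed.

Lemma conv_code0 : conv_code [set 0 : 'rV[{poly F}]_n]%classic 0 0.
Proof.
exists 0; split; [exact: generator_matrix0 | | exact: max_minor_degree0].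
by exists 0; apply/matrixP => -[].
Qed.

Lemma Forney_indices0 : Forney_indices [set 0 : 'rV[{poly F}]_n]%classic [::].
Proof.
exists 0%N, 0; rewrite (size0nil (size_enum_ord 0)); split=> //.
by split; [exact: generator_matrix0 | rewrite big_ord0 max_minor_degree0].
Qed.

Section TwoModules.
Variables (E1 E2 : 'M[F]_n) (S1 S2 : set 'rV[{poly F}]_n).
Hypotheses (fix1 : fixed_by E1 S1) (fix2 : fixed_by E2 S2).
Hypotheses (E12 : E1 *m E2 = 0) (E21 : E2 *m E1 = 0).

Lemma generator_matrix_sum2 k1 k2 (G1 : 'M_(k1, n)) (G2 : 'M_(k2, n)) :
    generator_matrix G1 S1 -> generator_matrix G2 S2 ->
  generator_matrix (col_mx G1 G2) (sum2 S1 S2) /\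
  max_minor_degree (col_mx G1 G2)
    = (max_minor_degree G1 + max_minor_degree G2)%N.
Proof.
move=> [rk1 im1] [rk2 im2].
have G11 : G1 *m constmx E1 = G1 by apply: fixed_by_mulmx; rewrite -im1.
have G22 : G2 *m constmx E2 = G2 by apply: fixed_by_mulmx; rewrite -im2.
have G12 := constmxM_eq0 G11 E12; have G21 := constmxM_eq0 G22 E21.
split; last exact: (max_minor_degree_col_mx G11 G22).
by split; [exact: (rank_col_mx_separated G11 G22) | rewrite im_col_mx im1 im2].
Qed.

Lemma conv_code_sum2 k1 k2 d1 d2 :
    conv_code S1 k1 d1 -> conv_code S2 k2 d2 ->
  conv_code (sum2 S1 S2) (k1 + k2)%N (d1 + d2)%N.
Proof.
move=> [G1 [gen1 [H1 GH1] deg1]] [G2 [gen2 [H2 GH2] deg2]].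
have [gen deg] := generator_matrix_sum2 gen1 gen2.
exists (col_mx G1 G2); split=> //; last by rewrite deg deg1 deg2.
have G11 : G1 *m constmx E1 = G1 by apply: fixed_by_mulmx; rewrite -gen1.2.
have G22 : G2 *m constmx E2 = G2 by apply: fixed_by_mulmx; rewrite -gen2.2.
(* The factors E1 and E2 make the off-diagonal products vanish. *)
exists (row_mx (constmx E1 *m H1) (constmx E2 *m H2)).
rewrite mul_col_mx !mul_mx_row !mulmxA G11 G22 GH1 GH2.
rewrite (constmxM_eq0 G11 E12) (constmxM_eq0 G22 E21) !mul0mx.
by rewrite -[col_mx _ _]/(block_mx _ _ _ _) -scalar_mx_block.
Qed.

Lemma Forney_indices_sum2 s1 s2 :
    Forney_indices S1 s1 -> Forney_indices S2 s2 ->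
  Forney_indices (sum2 S1 S2) (s1 ++ s2).
Proof.
move=> [k1 [G1 [[gen1 deg1] perm1]]] [k2 [G2 [[gen2 deg2] perm2]]].
have [gen deg] := generator_matrix_sum2 gen1 gen2.
have rowL i : row_degree (col_mx G1 G2) (lshift k2 i) = row_degree G1 i.
  by apply: eq_bigr => j _; rewrite col_mxEu.
have rowR i : row_degree (col_mx G1 G2) (rshift k1 i) = row_degree G2 i.
  by apply: eq_bigr => j _; rewrite col_mxEd.
exists (k1 + k2)%N, (col_mx G1 G2); split.
  split=> //; rewrite deg -deg1 -deg2 big_split_ord /=.
  by congr (_ + _)%N; apply: eq_bigr => i _.
have countE k (f : 'I_k -> nat) (a : pred nat) :
    count a [seq f i | i <- enum 'I_k] = (\sum_(i < k) a (f i))%N.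
  by rewrite -sum1_count big_map big_enum_cond /= big_mkcond /=.
apply/seq.permP => a; rewrite count_cat (seq.permP perm1) (seq.permP perm2).
rewrite !countE big_split_ord /=; congr (_ + _)%N; apply: eq_bigr => i _.
  by rewrite rowL.
by rewrite rowR.
Qed.

End TwoModules.

Section Family.

Lemma sum_modules0 (C : 'I_0 -> set 'rV[{poly F}]_n) :
  sum_modules C = [set 0]%classic.
Proof.
apply/seteqP; split=> [_ [c _ ->]|_ ->] /=; first by rewrite big_ord0.
by exists (fun=> 0) => [[]|] //; rewrite big_ord0.
Qed.

Lemma sum_modules_recl t (C : 'I_t.+1 -> set 'rV[{poly F}]_n) :
  sum_modules C = sum2 (C ord0) (sum_modules (fun i => C (lift ord0 i))).
Proof.
apply/seteqP; split=> [_ [c Cc ->]|_ [v [_ [Cv [c Cc ->] ->]]]] /=.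
  rewrite big_ord_recl; exists (c ord0), (\sum_i c (lift ord0 i)).
  by split=> //; exists (fun i => c (lift ord0 i)).
exists (fun i => if unlift ord0 i is Some j then c j else v).
  by move=> i; case: unliftP => [j|] ->.
rewrite big_ord_recl unlift_none; congr (_ + _).
by apply: eq_bigr => i _; rewrite liftK.
Qed.

Lemma sum_modules_fixed t (C : 'I_t -> set 'rV[{poly F}]_n)
    (E : 'I_t -> 'M[F]_n) :
    (forall i, fixed_by (E i) (C i)) ->
    (forall i j, i != j -> E i *m E j = 0) ->
  fixed_by (\sum_i E i) (sum_modules C).
Proof.
move=> fixC orthE _ [c Cc ->]; rewrite mulmx_suml; apply: eq_bigr => i _.
rewrite raddf_sum mulmx_sumr (bigD1 i) //= fixC // big1 ?addr0 // => j ne_ji.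
by apply: constmxM_eq0 (orthE i j _); rewrite ?fixC // eq_sym.
Qed.

(** Sums over a family reduce to sums of two modules, as the sum of all but the
    first module is fixed by the sum of their matrices, which is orthogonal to
    the first matrix. *)
Lemma sum_modules_ind (X : Type) (idx : X) (op : X -> X -> X)
    (P : set 'rV[{poly F}]_n -> X -> Prop) :
    P [set 0]%classic idx ->
    (forall E1 E2 S1 S2 x1 x2, fixed_by E1 S1 -> fixed_by E2 S2 ->
       E1 *m E2 = 0 -> E2 *m E1 = 0 -> P S1 x1 -> P S2 x2 ->
       P (sum2 S1 S2) (op x1 x2)) ->
  forall t (C : 'I_t -> set 'rV[{poly F}]_n) (E : 'I_t -> 'M[F]_n)
      (x : 'I_t -> X),
    (forall i, fixed_by (E i) (C i)) ->
    (forall i j, i != j -> E i *m E j = 0) ->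
    (forall i, P (C i) (x i)) ->
  P (sum_modules C) (\big[op/idx]_(i < t) x i).
Proof.
move=> P0 Pop; elim=> [|t IH] C E x fixC orthE Px.
  by rewrite sum_modules0 big_ord0.
rewrite sum_modules_recl big_ord_recl.
apply: (Pop (E ord0) (\sum_i E (lift ord0 i))) => //.
- by apply: sum_modules_fixed => // i j ne_ij; rewrite orthE.
- by rewrite mulmx_sumr big1 // => i _; rewrite orthE.
- by rewrite mulmx_suml big1 // => i _; rewrite orthE.
by apply: IH (fun i => E (lift ord0 i)) _ _ _ _ => // i j ne_ij; rewrite orthE.
Qed.

Variables (t : nat) (C : 'I_t -> set 'rV[{poly F}]_n) (E : 'I_t -> 'M[F]_n).
Hypothesis fixC : forall i, fixed_by (E i) (C i).
Hypothesis orthE : forall i j, i != j -> E i *m E j = 0.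

Lemma conv_code_sum_modules (k delta : 'I_t -> nat) :
    (forall i, conv_code (C i) (k i) (delta i)) ->
  conv_code (sum_modules C) (\sum_(i < t) k i)%N (\sum_(i < t) delta i)%N.
Proof.
move=> codeC; pose op (x y : nat * nat) := ((x.1 + y.1)%N, (x.2 + y.2)%N).
have bigE : \big[op/(0, 0)%N]_(i < t) (k i, delta i)
    = ((\sum_(i < t) k i)%N, (\sum_(i < t) delta i)%N).
  by apply: (big_rec3 (fun x a b => x = (a, b))) => // i x a b _ ->.
have: conv_code (sum_modules C) (\big[op/(0, 0)%N]_(i < t) (k i, delta i)).1
    (\big[op/(0, 0)%N]_(i < t) (k i, delta i)).2.
  apply: (sum_modules_ind (P := fun S x => conv_code S x.1 x.2) _ _ fixC orthE).
  - exact: conv_code0.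
  - by move=> E1 E2 S1 S2 x1 x2 f1 f2 E12 E21; apply: (conv_code_sum2 f1 f2).
  - exact: codeC.
by rewrite bigE.
Qed.

Lemma Forney_indices_sum_modules (s : 'I_t -> seq nat) :
    (forall i, Forney_indices (C i) (s i)) ->
  Forney_indices (sum_modules C) (flatten [seq s i | i <- enum 'I_t]).
Proof.
move=> sC; rewrite /flatten foldrE big_map.
have -> : enum 'I_t = index_enum 'I_t by rewrite enumT [index_enum _]unlock.
apply: (sum_modules_ind _ _ fixC orthE) sC; first exact: Forney_indices0.
by move=> E1 E2 S1 S2 x1 x2 f1 f2 E12 E21; apply: (Forney_indices_sum2 f1 f2).
Qed.

Lemma direct_sum_of_separated : direct_sum_of (sum_modules C) C.
Proof.
split=> // c Cc sum0 i.
have: (\sum_j c j) *m constmx (E i) = 0 by rewrite sum0 mul0mx.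
rewrite mulmx_suml (bigD1 i) //= fixC // big1 ?addr0 // => j ne_ji.
exact: constmxM_eq0 (fixC (Cc j)) (orthE ne_ji).
Qed.

End Family.
End SeparatedSums.

(** * The cyclic algebra and its primitive idempotents *)

Section PolyFacts.
Variable F : fieldType.
Implicit Types p q : {poly F}.

Lemma irreducible_dvdpM (u p q : {poly F}) :
  irreducible_poly u -> u %| p * q = (u %| p) || (u %| q).
Proof.
move=> irr_u; have [up|up] := boolP (u %| p); first by rewrite dvdp_mulr.
by rewrite Gauss_dvdpr // irreducible_poly_coprime.
Qed.

Lemma irreducible_monic_coprime p q :
    p \is monic -> q \is monic -> irreducible_poly p -> irreducible_poly q ->
  p != q -> coprimep p q.
Proof.
move=> mp mq irr_p irr_q; rewrite irreducible_poly_coprime //.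
apply: contraNN => pq; rewrite -eqp_monic //.
by apply: irr_q.2 => //; rewrite neq_ltn irr_p.1 orbT.
Qed.

Lemma coprimep_bigprod (I : Type) (s : seq I) (P : pred I)
    (f : I -> {poly F}) p :
  (forall i, P i -> coprimep p (f i)) -> coprimep p (\prod_(i <- s | P i) f i).
Proof.
move=> cop; apply: (big_ind (fun q => coprimep p q)) => //.
  exact: coprimep1.
by move=> q1 q2 c1 c2; rewrite coprimepMr c1.
Qed.

Lemma bigprod_dvdp (I : finType) (f : I -> {poly F}) p :
    (forall i j, i != j -> coprimep (f i) (f j)) ->
    (forall i, f i %| p) ->
  \prod_i f i %| p.
Proof.
move=> cop div_p; have : uniq (index_enum I) by apply: index_enum_uniq.
elim: (index_enum I) => [|i s IH] /=; first by rewrite big_nil dvd1p.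
case/andP=> nis us; rewrite big_cons Gauss_dvdp ?div_p ?IH //.
rewrite big_seq; apply: coprimep_bigprod => j js; apply: cop.
by apply: contraNneq nis => ->.
Qed.

End PolyFacts.

Section CyclicAlgebra.
Variables (F : finFieldType) (n : nat).
Hypothesis n_gt0 : (0 < n)%N.
Local Notation A := (cyclic_alg F n).

Lemma mk_monic_cyclic : mk_monic ('X^n - 1 : {poly F}) = 'X^n - 1.
Proof.
rewrite /mk_monic -[1]/(1%:P) size_XnsubC // ltnS n_gt0.
by rewrite monicXnsubC.
Qed.

Lemma size_cyclic (a : A) : (size (a : {poly F}) <= n)%N.
Proof.
rewrite -ltnS; apply: leq_trans (size_mk_monic a) _.
by rewrite mk_monic_cyclic -[1]/(1%:P) size_XnsubC.
Qed.

Lemma in_qpoly_val (a : A) : in_qpoly ('X^n - 1) (a : {poly F}) = a.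
Proof. by apply: val_inj; apply: in_qpoly_small; apply: size_mk_monic. Qed.

Definition row_of_poly (a : A) : 'rV[F]_n := poly_rV (a : {poly F}).

Lemma row_of_polyK : cancel row_of_poly (@poly_of_row F n).
Proof.
by move=> a; rewrite /poly_of_row poly_rV_K ?size_cyclic // in_qpoly_val.
Qed.

Lemma poly_of_rowK : cancel (@poly_of_row F n) row_of_poly.
Proof.
move=> v; rewrite /row_of_poly /poly_of_row in_qpoly_small ?rVpolyK //.
by rewrite mk_monic_cyclic -[1]/(1%:P) size_XnsubC // ltnS size_poly.
Qed.

Lemma poly_of_row_is_linear : linear (@poly_of_row F n).
Proof. by move=> c u v; rewrite /poly_of_row !linearP. Qed.
HB.instance Definition _ := GRing.isLinear.Build F 'rV[F]_n A _
  (@poly_of_row F n) poly_of_row_is_linear.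

Variables (r : nat) (pi : 'I_r -> {poly F}).
Hypothesis pi_fact : is_factorization n pi.

Let pi_irr j : irreducible_poly (pi j).
Proof. by case: pi_fact => _ /(_ j)[]. Qed.

(** The elements vanishing at [j] form the prime ideal generated by [pi j].
    These primes intersect in zero, so identities between idempotents can be
    tested modulo each of them. *)
Definition vanish j (a : A) := pi j %| (a : {poly F}).

(** Reduction modulo [x^n - 1] preserves divisibility by its factor [pi j]. *)
Lemma vanish_in_qpoly j p : vanish j (in_qpoly ('X^n - 1) p) = (pi j %| p).
Proof.
case: pi_fact => fact _ _ _; rewrite /vanish.
have monh : 'X^n - 1 \is @monic F by rewrite -[1]/(1%:P) monicXnsubC.
have pih : pi j %| 'X^n - 1 by rewrite fact (bigD1 j) //= dvdp_mulr.
rewrite /= mk_monic_cyclic -Pdiv.IdomainMonic.modpE //.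
by rewrite -dvdp_mod.
Qed.

Lemma vanishM j a b : vanish j (a * b) = vanish j a || vanish j b.
Proof.
by rewrite -irreducible_dvdpM // -vanish_in_qpoly in_qpolyM !in_qpoly_val.
Qed.

Lemma vanishD j a b : vanish j a -> vanish j b -> vanish j (a + b).
Proof. by move=> va vb; exact: dvdp_add va vb. Qed.

Lemma vanishBl j a b : vanish j (a - b) -> vanish j a = vanish j b.
Proof. by move=> vab; rewrite /vanish -(subrK b a) (dvdp_addr _ vab). Qed.

Lemma vanish0 j : vanish j 0.
Proof. by rewrite /vanish dvdp0. Qed.

Lemma vanish_all a : (forall j, vanish j a) -> a = 0.
Proof.
case: pi_fact => fact pi_mon pi_inj _ va.
have: \prod_i pi i %| (a : {poly F}).
  apply: bigprod_dvdp => // i j ne_ij.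
  have [mi irr_i] := pi_mon i; have [mj irr_j] := pi_mon j.
  by apply: irreducible_monic_coprime; rewrite ?(inj_eq pi_inj).
rewrite -fact => ha.
apply: val_inj; apply/eqP; apply: contraT => /dvdp_leq/(_ ha).
by rewrite -[1]/(1%:P) size_XnsubC // ltnNge size_cyclic.
Qed.

Lemma vanish_eq a b : (forall j, vanish j (a - b)) -> a = b.
Proof. by move/vanish_all/eqP; rewrite subr_eq0 => /eqP. Qed.

Variable eps : 'I_r -> A.
Hypothesis epsP : is_primitive_idempotents pi eps.

Lemma vanish_epsB l : vanish l (eps l - 1).
Proof. by have := epsP l l; rewrite eqxx. Qed.

Lemma vanish_eps l j : vanish j (eps l) = (l != j).
Proof.
have [<-|/negPf ne_lj] := eqVneq l j.
  rewrite (vanishBl (vanish_epsB l)) /vanish dvdp1.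
  by apply: gtn_eqF; case: (pi_irr l).
by have := epsP l j; rewrite ne_lj subr0.
Qed.

(** [a (eps l)] already vanishes at all primes but [pi l]. In other words,
    [A (eps l)] is the residue field at [pi l]. *)
Lemma mul_eps_eq0 l a : (a * eps l == 0) = vanish l a.
Proof.
apply/eqP/idP=> [a0|va].
  by have := vanish0 l; rewrite -a0 vanishM vanish_eps eqxx orbF.
apply: vanish_all => j; rewrite vanishM vanish_eps.
by have [<-|] := eqVneq l j; rewrite ?va ?orbT.
Qed.

Lemma mul_eps_id l a : vanish l (a - 1) -> a * eps l = eps l.
Proof.
move=> va; apply/eqP; rewrite -subr_eq0 -{2}[eps l]mul1r -mulrBl.
by rewrite mul_eps_eq0.
Qed.

Lemma eps_idem l : eps l * eps l = eps l.
Proof. exact: mul_eps_id (vanish_epsB l). Qed.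

Lemma eps_orth k l : k != l -> eps k * eps l = 0.
Proof. by move=> ne_kl; apply/eqP; rewrite mul_eps_eq0 vanish_eps. Qed.

Lemma eps_neq0 l : eps l != 0.
Proof. by rewrite -eps_idem mul_eps_eq0 vanish_eps eqxx. Qed.

Lemma sum_eps : \sum_l eps l = 1.
Proof.
apply: vanish_eq => j; rewrite (bigD1 j) //= addrAC; apply: vanishD.
  exact: vanish_epsB.
apply: (big_ind (vanish j)) => [|a b|l ne_lj]; rewrite ?vanish0 //.
  exact: vanishD.
by rewrite vanish_eps.
Qed.

Lemma idempotent_vanish l x : x * x = x -> vanish l x || vanish l (x - 1).
Proof. by move=> xx; rewrite -vanishM mulrBr mulr1 xx subrr vanish0. Qed.

Variable sigma : {lrmorphism A -> A}.
Hypothesis sigma_bij : bijective sigma.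
Local Notation sig j := (iter j sigma).

Lemma iter_inj j : injective (sig j).
Proof. by elim: j => //= j IH a b /(bij_inj sigma_bij) /IH. Qed.

Lemma iter_surj j a : exists b, sig j b = a.
Proof.
case: sigma_bij => tau _ tauK; exists (iter j tau a).
by elim: j a => //= j IH a; rewrite -iterS iterSr tauK.
Qed.

(** At [pi l2] the idempotent [sigma^i (eps l1)] is congruent to zero or one.
    In the latter case the preimage [y] of [eps l2] under [sigma^i] is a nonzero
    idempotent of the field [A (eps l1)], hence equal to [eps l1], which makes
    [l1] and [l2] equivalent. *)
Lemma iter_eps_orth i l1 l2 :
  ~ idem_equiv sigma eps l1 l2 -> sig i (eps l1) * eps l2 = 0.
Proof.
move=> neq; set x := sig i (eps l1).
have sigM a b : sig i (a * b) = sig i a * sig i b by apply: iter_rmorphM.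
have xx : x * x = x by rewrite -sigM eps_idem.
apply/eqP; rewrite mul_eps_eq0.
case/orP: (idempotent_vanish l2 xx) => // /mul_eps_id xe; exfalso.
have [y ey] := iter_surj i (eps l2).
have ly : eps l1 * y = y by apply: (@iter_inj i); rewrite sigM ey.
have yy : y * y = y by apply: (@iter_inj i); rewrite sigM ey eps_idem.
case/orP: (idempotent_vanish l1 yy).
  rewrite -mul_eps_eq0 mulrC ly => /eqP y0.
  by have := eps_neq0 l2; rewrite -ey y0 iter_rmorph0 eqxx.
move/mul_eps_id; rewrite mulrC ly => yE.
by apply: neq; exists i; rewrite -yE.
Qed.

(** The central idempotent of the skew polynomial ring that belongs to the
    equivalence class of [l]. *)
Definition class_idem l : A := \sum_(k | `[< idem_equiv sigma eps l k >]) eps k.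

Lemma class_idem_iter l j : class_idem l * sig j (eps l) = sig j (eps l).
Proof.
rewrite -[RHS]mul1r -sum_eps /class_idem mulr_suml big_mkcond mulr_suml.
apply: eq_bigr => k _; case: asboolP => // neq.
by rewrite mulrC iter_eps_orth.
Qed.

Lemma class_idem_orth l1 l2 :
    ~ idem_equiv sigma eps l1 l2 -> ~ idem_equiv sigma eps l2 l1 ->
  class_idem l1 * class_idem l2 = 0.
Proof.
move=> n12 n21; rewrite /class_idem mulr_suml big1 // => k /asboolP[i ik].
rewrite mulr_sumr big1 // => k' /asboolP[j jk].
have [eq_kk|] := eqVneq k k'; last exact: eps_orth.
move: jk; rewrite -eq_kk -ik => {k k' eq_kk ik} eq_ij.
case: (leqP i j) => [le_ij|/ltnW le_ji].
  case: n21; exists (j - i)%N; apply: (@iter_inj i).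
  by rewrite -iterD subnKC.
case: n12; exists (i - j)%N; apply: (@iter_inj j).
by rewrite -iterD subnKC.
Qed.

End CyclicAlgebra.

(** * From left ideals to separated modules *)

Section CodesAndIdeals.
Variables (F : finFieldType) (n : nat).
Hypothesis n_gt0 : (0 < n)%N.
Local Notation A := (cyclic_alg F n).
Local Notation constmx := (map_mx (@polyC F)).

Definition mulA_row (a : A) (v : 'rV[F]_n) : 'rV[F]_n :=
  row_of_poly (a * poly_of_row v).

Lemma mulA_row_is_linear a : linear (mulA_row a).
Proof.
move=> c u v; rewrite /mulA_row /row_of_poly linearP mulrDr -scalerAr.
by rewrite poly_of_qpolyD poly_of_qpolyZ linearP.
Qed.
HB.instance Definition _ a := GRing.isLinear.Build F 'rV[F]_n 'rV[F]_n _
  (mulA_row a) (mulA_row_is_linear a).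

Definition mulA_mx (a : A) : 'M[F]_n := lin1_mx (mulA_row a).

Lemma mulA_mxE a v : poly_of_row (v *m mulA_mx a) = a * poly_of_row v.
Proof. by rewrite mul_rV_lin1 /= row_of_polyK. Qed.

Lemma mulA_mx_eq0 a b : a * b = 0 -> mulA_mx a *m mulA_mx b = 0.
Proof.
move=> ab0; apply/row_matrixP => i; rewrite rowE mulmxA.
apply: (can_inj (poly_of_rowK n_gt0)).
by rewrite !mulA_mxE mulrA [b * a]mulrC ab0 mul0r row0 linear0.
Qed.

Variable sigma : {lrmorphism A -> A}.
Local Notation sig j := (iter j sigma).
Local Notation skew := (skew_poly sigma).
Local Notation p := (@poly_of_vec F n sigma).

Definition row_coef (v : 'rV[{poly F}]_n) m : 'rV[F]_n :=
  \row_(i < n) (v ord0 i)`_m.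

Lemma coef_poly_of_vec v m : (p v)`_m = poly_of_row (row_coef v m).
Proof.
rewrite coef_poly; case: ltnP => // le_m.
have -> : row_coef v m = 0; last by rewrite linear0.
apply/rowP => i; rewrite !mxE nth_default //.
by apply: leq_trans le_m; apply: (leq_bigmax i).
Qed.

Lemma poly_of_vecP v (f : skew) :
  (forall m, poly_of_row (row_coef v m) = f`_m) -> p v = f.
Proof. by move=> vf; apply/polyP => m; rewrite coef_poly_of_vec. Qed.

Lemma poly_of_vec_inj : injective p.
Proof.
move=> u v eq_uv; apply/rowP => i; apply/polyP => m.
have: row_coef u m = row_coef v m.
  by apply: (can_inj (poly_of_rowK n_gt0)); rewrite -!coef_poly_of_vec eq_uv.
by move/rowP/(_ i); rewrite !mxE.
Qed.

Lemma poly_of_vec_surj (f : skew) : exists v, p v = f.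
Proof.
exists (\row_i \poly_(m < size (f : {poly A})) (row_of_poly f`_m) 0 i).
apply: poly_of_vecP => m; rewrite -[RHS](row_of_polyK n_gt0); congr poly_of_row.
apply/rowP => i; rewrite !mxE coef_poly; case: ltnP => [|le_m].
  by rewrite mxE.
by rewrite (nth_default _ le_m) coef0.
Qed.

Lemma poly_of_vecD u v : p (u + v) = p u + p v.
Proof.
apply: poly_of_vecP => m; rewrite coefD !coef_poly_of_vec -linearD.
by congr poly_of_row; apply/rowP => i; rewrite !mxE coefD.
Qed.

Lemma poly_of_vec0 : p 0 = 0.
Proof.
apply: poly_of_vecP => m; rewrite coef0 (_ : row_coef 0 m = 0) ?linear0 //.
by apply/rowP => i; rewrite !mxE coef0.
Qed.

Lemma poly_of_vec_sum I (s : seq I) (P : pred I) (v : I -> 'rV[{poly F}]_n) :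
  p (\sum_(i <- s | P i) v i) = \sum_(i <- s | P i) p (v i).
Proof. exact: (big_morph _ poly_of_vecD poly_of_vec0). Qed.

Lemma coef_poly_of_vec_mulA v a m :
  (p (v *m constmx (mulA_mx a)))`_m = a * (p v)`_m.
Proof.
rewrite !coef_poly_of_vec -mulA_mxE; congr poly_of_row.
apply/rowP => j; rewrite !mxE coef_sum; apply: eq_bigr => i _.
by rewrite [constmx _ i j]mxE coefMC !mxE.
Qed.

(** The left [F[z]]-module structure of the skew polynomial ring comes from this
    embedding. Since [sigma] fixes the scalars, products with embedded
    polynomials on the left obey the commutative convolution formula. *)
Definition scalar_skew (c : {poly F}) : skew := map_poly (in_alg A) c.

Lemma iter_sigma_scalar j (c : F) : sig j (c%:A) = c%:A.
Proof. by elim: j => //= j ->; rewrite linearZ /= rmorph1. Qed.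

Lemma coef_scalar_skewM c (f : skew) m :
  (scalar_skew c * f)`_m = \sum_(j < m.+1) c`_(m - j) *: f`_j.
Proof.
rewrite coef_skew_mul; apply: eq_bigr => j _.
by rewrite coef_map iter_sigma_scalar mulr_algl.
Qed.

Lemma poly_of_vecZ c v : p (c *: v) = scalar_skew c * p v.
Proof.
apply: poly_of_vecP => m; rewrite coef_scalar_skewM.
under eq_bigr do rewrite coef_poly_of_vec -linearZ.
rewrite -linear_sum; congr poly_of_row; apply/rowP => i.
by rewrite summxE !mxE coefMr; apply: eq_bigr => j _; rewrite !mxE.
Qed.

Lemma coef_skewC_mul a (f : skew) m : (skewC sigma a * f)`_m = sig m a * f`_m.
Proof.
rewrite coef_skew_mul big_ord_recr /= subnn coefC eqxx big1 ?add0r // => j _.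
by rewrite coefC subn_eq0 leqNgt ltn_ord iter_rmorph0 mul0r.
Qed.

Lemma coef_mul_skewC a (f : skew) m : (f * skewC sigma a)`_m = f`_m * a.
Proof.
rewrite coef_skew_mul big_ord_recl /= subn0 coefC eqxx big1 ?addr0 // => j _.
by rewrite coefC mulr0.
Qed.

Lemma left_ideal_sum_modules t (C : 'I_t -> set 'rV[{poly F}]_n) :
    (forall i, left_ideal [set p v | v in C i]%classic) ->
  left_ideal [set p v | v in sum_modules C]%classic.
Proof.
move=> idC; split.
  exists 0; last exact: poly_of_vec0.
  exists (fun=> 0); last by rewrite big1.
  move=> i; have [[v Cv v0] _] := idC i.
  by rewrite -(poly_of_vec_inj (etrans v0 (esym poly_of_vec0))).
move=> a _ _ [_ [u Cu ->] <-] [_ [v Cv ->] <-].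
have /choice[w Cw] : forall i, exists w, C i w /\ p w = a * p (u i) + p (v i).
  move=> i; have [_ /(_ a (p (u i)) (p (v i)))[]] := idC i.
  - by exists (u i).
  - by exists (v i).
  by move=> w Cw pw; exists w.
exists (\sum_i w i); first by exists w => // i; case: (Cw i).
rewrite !poly_of_vec_sum mulr_sumr -big_split /=.
by apply: eq_bigr => i _; case: (Cw i).
Qed.

Variables (r : nat) (pi : 'I_r -> {poly F}).
Hypothesis pi_fact : is_factorization n pi.
Variable eps : 'I_r -> A.
Hypothesis epsP : is_primitive_idempotents pi eps.
Hypothesis sigma_bij : bijective sigma.

(** * The rank of a code supported at one index *)

Section OneSupport.
Variables (g : skew) (l : 'I_r).
Hypothesis supp_g : skew_support eps g = [set l]%SET.

(** Moving [eps l] to the right of [z^m] turns it into [sigma^m (eps l)]. *)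
Lemma support1_coef m : sig m (eps l) * g`_m = g`_m.
Proof.
rewrite -[RHS]mul1r -(iter_rmorph1 sigma m) -(sum_eps n_gt0 pi_fact epsP).
rewrite (big_morph _ (iter_rmorphD sigma m) (iter_rmorph0 sigma m)) mulr_suml.
rewrite (bigD1 l) //= big1 ?addr0 // => k ne_kl.
have: k \notin skew_support eps g by rewrite supp_g finset.in_set1.
rewrite inE negbK => /eqP/(congr1 (fun f : {poly A} => f`_m)).
by rewrite /component coef_skewC_mul coef0.
Qed.

Lemma support1_mul (f : skew) : f * skewC sigma (eps l) * g = f * g.
Proof.
rewrite -mulrA; congr (f * _); apply/polyP => m.
by rewrite coef_skewC_mul support1_coef.
Qed.

Lemma support1_neq0 : g <> 0.
Proof.
move=> g0; have: l \in skew_support eps g by rewrite supp_g finset.in_set1.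
by rewrite inE g0 /component mulr0 eqxx.
Qed.

(** The coefficients of a left multiple of [g] are sums of multiples of elements
    [sigma^j (eps l)], and these are fixed by the idempotent of the class. *)
Lemma fixed_by_class_idem (C : set 'rV[{poly F}]_n) :
    [set p v | v in C]%classic = principal_left_ideal g ->
  fixed_by (mulA_mx (class_idem eps sigma l)) C.
Proof.
move=> pC v Cv; apply: poly_of_vec_inj; apply/polyP => m.
have [f _ fg] : principal_left_ideal g (p v) by rewrite -pC; exists v.
rewrite coef_poly_of_vec_mulA -fg coef_skew_mul mulr_sumr.
apply: eq_bigr => j _; rewrite mulrCA; congr (_ * _).
by rewrite -support1_coef mulrA (class_idem_iter n_gt0 pi_fact epsP sigma_bij).
Qed.

(** With [w] and [g] of degrees [a] and [b], the coefficient of [w g] at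
    [z^(a + b)] is [sigma^b (w_a) g_b]. Applying [sigma^-b] brings both factors
    into the field [A (eps l)], where they are nonzero. *)
Lemma mulf_support1_inj (w : skew) :
  (forall m, w`_m * eps l = w`_m) -> w * g = 0 -> w = 0.
Proof.
move=> w_l wg0; apply/eqP; apply: contraT => w_nz; exfalso.
have g_nz : (g : {poly A}) != 0 by apply/eqP; apply: support1_neq0.
set a := (size (w : {poly A})).-1; set b := (size (g : {poly A})).-1.
have wa_nz : w`_a != 0 by rewrite -[w`_a]/(lead_coef _) lead_coef_eq0.
have gb_nz : g`_b != 0 by rewrite -[g`_b]/(lead_coef _) lead_coef_eq0.
have: sig b w`_a * g`_b = 0.
  move/(congr1 (fun f : {poly A} => f`_(a + b))): wg0.
  rewrite coef0 coef_skew_mul => wg0; rewrite -[RHS]wg0.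
  have lt_b : (b < (a + b).+1)%N by rewrite ltnS leq_addl.
  rewrite (bigD1 (Ordinal lt_b)) //= addnK big1 ?addr0 // => j ne_jb.
  case: (ltngtP j b) => [lt_jb | lt_bj | eq_jb].
  - rewrite (nth_default 0 (_ : size (w : {poly A}) <= _)%N).
      by rewrite iter_rmorph0 mul0r.
    by rewrite -[size _]prednK ?size_poly_gt0 // -/a ltn_subRL addnC ltn_add2l.
  - rewrite [g`_j]nth_default ?mulr0 //.
    by rewrite -[size _]prednK ?size_poly_gt0.
  - by case/eqP: ne_jb; apply: val_inj.
have [g' g'E] := iter_surj sigma_bij b g`_b.
have g'l : eps l * g' = g'.
  apply: (iter_inj sigma_bij (j := b)).
  by rewrite iter_rmorphM g'E support1_coef.
have g'_nz : g' != 0.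
  by apply: contra_neq gb_nz => g'0; rewrite -g'E g'0 iter_rmorph0.
rewrite -g'E -(iter_rmorphM sigma) -{2}(iter_rmorph0 sigma b).
move/(iter_inj sigma_bij) => wg'0.
have := @vanish0 F n _ pi l; rewrite -wg'0 (vanishM n_gt0 pi_fact).
rewrite -!(mul_eps_eq0 n_gt0 pi_fact epsP) w_l mulrC g'l.
by rewrite (negPf wa_nz) (negPf g'_nz).
Qed.

Local Notation d := (size (pi l)).-1.
(** The classes of [x^a] for [a < deg (pi l)], an [F]-basis of the residue field
    [F[x]/(pi l)], seen in its copy [A (eps l)] inside [A]. *)
Definition field_basis (a : 'I_d) : A := in_qpoly ('X^n - 1) 'X^a * eps l.

Lemma field_basis_sum (c : nat -> F) :
  \sum_(a < d) c a *: field_basis a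
    = in_qpoly ('X^n - 1) (\poly_(a < d) c a) * eps l.
Proof.
rewrite poly_def rmorph_sum mulr_suml; apply: eq_bigr => a _.
by rewrite /field_basis scalerAl -in_qpolyZ.
Qed.

Let pi_gt0 : (0 < size (pi l))%N.
Proof. by case: pi_fact => _ /(_ l)[_ [/ltnW]]. Qed.

Lemma field_basis_free (c : nat -> F) :
  \sum_(a < d) c a *: field_basis a = 0 -> forall a : 'I_d, c a = 0.
Proof.
rewrite field_basis_sum => /eqP.
rewrite (mul_eps_eq0 n_gt0 pi_fact epsP) (vanish_in_qpoly n_gt0 pi_fact).
move=> dv a.
have poly0 : \poly_(a < d) c a = 0.
  apply/eqP; apply: contraTT dv => /dvdp_leq le_pi; apply/negP => /le_pi.
  by rewrite leqNgt -[X in (_ < X)%N](prednK pi_gt0) ltnS size_poly.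
have := congr1 (fun q : {poly F} => q`_a) poly0.
by rewrite coef0 coef_poly ltn_ord.
Qed.

Lemma field_basis_span (b : A) :
  \sum_(a < d) ((b : {poly F}) %% pi l)`_a *: field_basis a = b * eps l.
Proof.
rewrite (field_basis_sum (fun a => ((b : {poly F}) %% pi l)`_a)).
have -> : \poly_(a < d) ((b : {poly F}) %% pi l)`_a = (b : {poly F}) %% pi l.
  apply/polyP => a; rewrite coef_poly; case: ltnP => // le_da.
  rewrite nth_default //; apply: leq_trans le_da.
  by rewrite -ltnS prednK // ltn_modp -size_poly_gt0.
apply/eqP; rewrite -subr_eq0 -mulrBl (mul_eps_eq0 n_gt0 pi_fact epsP).
rewrite -{2}(in_qpoly_val b) -rmorphB (vanish_in_qpoly n_gt0 pi_fact).
by rewrite {2}(divp_eq b (pi l)) opprD addrCA subrr addr0 -mulNr dvdp_mull.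
Qed.

Section Generator.
Variable G : 'M[{poly F}]_(d, n).
Hypothesis pG : forall a, p (row a G) = skewC sigma (field_basis a) * g.

(** The left factor [w] such that [u G] corresponds to [w g]. *)
Definition skew_comb (u : 'rV[{poly F}]_d) : skew :=
  \sum_a scalar_skew (u 0 a) * skewC sigma (field_basis a).

Lemma coef_skew_comb u m :
  (skew_comb u)`_m = \sum_(a < d) (u 0 a)`_m *: field_basis a.
Proof.
rewrite /skew_comb coef_sum; apply: eq_bigr => a _.
by rewrite coef_mul_skewC coef_map mulr_algl.
Qed.

Lemma poly_of_vec_mulmx u : p (u *m G) = skew_comb u * g.
Proof.
rewrite mulmx_sum_row poly_of_vec_sum mulr_suml; apply: eq_bigr => a _.
by rewrite poly_of_vecZ pG mulrA.
Qed.

Lemma basis_matrix_inj (u : 'rV_d) : u *m G = 0 -> u = 0.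
Proof.
move=> uG0; have comb0 : skew_comb u = 0.
  apply: mulf_support1_inj; last by rewrite -poly_of_vec_mulmx uG0 poly_of_vec0.
  move=> m; rewrite coef_skew_comb mulr_suml; apply: eq_bigr => a _.
  by rewrite -scalerAl /field_basis -mulrA (eps_idem n_gt0 pi_fact epsP).
apply/rowP => a; apply/polyP => m; rewrite mxE coef0.
(* The coefficient family is extended by zero from ordinals to numbers. *)
pose c i := if insub i is Some a then (u 0 a)`_m else 0.
have cE (i : 'I_d) : c i = (u 0 i)`_m by rewrite /c valK.
rewrite -cE; apply: field_basis_free.
under eq_bigr do rewrite cE.
by rewrite -coef_skew_comb comb0 coef0.
Qed.

(** Coefficients of [f] may be reduced modulo [pi l], as only [f (eps l)]
    matters for [f g]. *)
Lemma basis_matrix_span (f : skew) : exists u, p (u *m G) = f * g.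
Proof.
pose q a m := ((f`_m : {poly F}) %% pi l)`_a.
exists (\row_a \poly_(m < size (f : {poly A})) q a m).
rewrite poly_of_vec_mulmx -(support1_mul f); congr (_ * g); apply/polyP => m.
rewrite coef_skew_comb coef_mul_skewC -field_basis_span.
apply: eq_bigr => a _; rewrite mxE coef_poly; case: ltnP => // le_m.
by rewrite /q (nth_default _ le_m) mod0p coef0.
Qed.

End Generator.

(** Two matrices with trivial kernels and the same row module have the same
    number of rows, as each is a multiple of the other. *)
Lemma rank_support1 (C : set 'rV[{poly F}]_n) k (G : 'M[{poly F}]_(k, n)) :
    generator_matrix G C ->
    [set p v | v in C]%classic = principal_left_ideal g ->
  k = d.
Proof.
move=> [/eqP/row_freeP[H GH] CG] pC.
have G_inj m (U : 'M_(m, k)) : U *m G = 0 -> U = 0.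
  move=> UG0; have fracU0 : map_mx (@tofrac {poly F}) U = 0.
    by rewrite -[LHS]mulmx1 -GH mulmxA -map_mxM UG0 raddf0 mul0mx.
  apply/matrixP => i j; apply/eqP; rewrite mxE -tofrac_eq0.
  by have /matrixP/(_ i j) := fracU0; rewrite !mxE => ->.
have [B pB] : exists B : 'M_(d, n),
    forall a, p (row a B) = skewC sigma (field_basis a) * g.
  have /choice[v pv] :=
    fun a => poly_of_vec_surj (skewC sigma (field_basis a) * g).
  by exists (\matrix_a v a) => a; rewrite rowK.
have B_inj m (U : 'M_(m, d)) : U *m B = 0 -> U = 0.
  move=> UB0; apply/row_matrixP => i; rewrite row0.
  by apply: (basis_matrix_inj pB); rewrite -row_mul UB0 row0.
have [U BE] : exists U, B = U *m G.
  have /choice[u uE] : forall a, exists u, u *m G = row a B.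
    move=> a; suff: C (row a B) by rewrite CG => -[u _ uE]; exists u.
    have: principal_left_ideal g (p (row a B)).
      by rewrite pB; exists (skewC sigma (field_basis a)).
    by rewrite -pC => -[v Cv /poly_of_vec_inj <-].
  exists (\matrix_a u a); apply/row_matrixP => a.
  by rewrite row_mul rowK uE.
have [V GE] : exists V, G = V *m B.
  have /choice[u uE] : forall a, exists u, u *m B = row a G.
    move=> a; have [f _ fg] : principal_left_ideal g (p (row a G)).
      by rewrite -pC; exists (row a G) => //; rewrite CG; apply: im_mx_row.
    have [u uE] := basis_matrix_span pB f.
    by exists u; apply: poly_of_vec_inj; rewrite uE fg.
  exists (\matrix_a u a); apply/row_matrixP => a.
  by rewrite row_mul rowK uE.
apply/eqP; rewrite eqn_leq; apply/andP; split.
  apply: (@mulmx1_min _ _ _ V U); apply/eqP; rewrite -subr_eq0; apply/eqP.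
  by apply: G_inj; rewrite mulmxBl mul1mx -mulmxA -BE -GE subrr.
apply: (@mulmx1_min _ _ _ U V); apply/eqP; rewrite -subr_eq0; apply/eqP.
by apply: B_inj; rewrite mulmxBl mul1mx -mulmxA -GE -BE subrr.
Qed.

End OneSupport.
End CodesAndIdeals.

(** * Sums of minimal codes with inequivalent supports *)

Theorem theorem4p4
  (F : finFieldType) (n : nat) (n_gt0 : (0 < n)%N) (co_n : coprime n #|F|)
  (r : nat) (pi : 'I_r -> {poly F}) (pi_fact : is_factorization n pi)
  (eps : 'I_r -> cyclic_alg F n) (epsP : is_primitive_idempotents pi eps)
  (sigma : {lrmorphism cyclic_alg F n -> cyclic_alg F n})
  (sigma_bij : bijective sigma)
  (t : nat) (C : 'I_t -> set 'rV[{poly F}]_n)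
  (l : 'I_t -> 'I_r) (k delta : 'I_t -> nat)
  (codeC : forall i, conv_code (C i) (k i) (delta i))
  (minC : forall i, minimal_code sigma eps (C i))
  (suppC : forall i, has_support sigma eps (C i) [set l i]%SET)
  (inequivC : forall i j, i != j -> ~ idem_equiv sigma eps (l i) (l j)) :
  [/\ sigma_cyclic sigma (sum_modules C),
      conv_code (sum_modules C) (\sum_(i < t) k i)%N (\sum_(i < t) delta i)%N,
      (\sum_(i < t) k i = \sum_(i < t) (size (pi (l i))).-1)%N,
      direct_sum_of (sum_modules C) C
    & forall s : 'I_t -> seq nat,
        (forall i, Forney_indices (C i) (s i)) ->
        Forney_indices (sum_modules C) (flatten [seq s i | i <- enum 'I_t])].
Proof.
have fixC i : fixed_by (mulA_mx (class_idem eps sigma (l i))) (C i).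
  have [g [_ pC] supp_g] := suppC i.
  exact: (fixed_by_class_idem n_gt0 pi_fact epsP sigma_bij supp_g pC).
have orthE i j : i != j ->
    mulA_mx (class_idem eps sigma (l i)) *m mulA_mx (class_idem eps sigma (l j))
      = 0.
  move=> ne_ij; apply: (mulA_mx_eq0 n_gt0).
  apply: (class_idem_orth n_gt0 pi_fact epsP sigma_bij); apply: inequivC => //.
  by rewrite eq_sym.
have codeS := conv_code_sum_modules fixC orthE codeC.
split=> //.
- split; first by exists (\sum_(i < t) k i)%N, (\sum_(i < t) delta i)%N.
  by apply: (left_ideal_sum_modules n_gt0) => i; case: (minC i) => -[].
- apply: eq_bigr => i _; have [g [_ pC] supp_g] := suppC i.
  have [G [genG _ _]] := codeC i.
  exact: (rank_support1 n_gt0 pi_fact epsP sigma_bij supp_g genG pC).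
- exact: direct_sum_of_separated fixC orthE.
- by move=> s; apply: (Forney_indices_sum_modules fixC orthE).
Qed.
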